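(* Let $\Omega=(0,\infty)$, $\lambda<0$ and $p\ge2$, and let $\varphi\in\mathcal{C}(\overline\Omega)$ be non-negative. Then the problem $$\begin{cases}\partial_t u=\partial_x^2u-u\,\partial_xu+u^p-\lambda u & \text{in }\overline\Omega\times(0,\infty),\\ \partial_\nu u=0 & \text{on }\partial\Omega\times(0,\infty),\\ u(\cdot,0)=\varphi & \text{in }\overline\Omega\end{cases}$$ admits no global positive solution $u$ satisfying the growth condition: for all $a>0$ and all $t>0$, $$\lim_{|x|\to\infty}u(x,t)e^{-a|x|}=0\quad\text{and}\quad\lim_{|x|\to\infty}|\partial_xu(x,t)|e^{-a|x|}=0 .$$
   Context: $\partial_\nu$ is the outward normal derivative, so $\partial_\nu u(0,t)=-\partial_xu(0,t)$. A global solution is a function $u\in\mathcal{C}(\overline\Omega\times[0,\infty))\cap\mathcal{C}^{2,1}(\overline\Omega\times(0,\infty))$ satisfying the equations in the classical sense. Positive means $u>0$ in $\Omega\times(0,\infty)$. *)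

(* Defs.v *)
From HB Require Import structures.
From mathcomp Require Import all_boot all_order all_algebra.
From mathcomp Require Import all_classical all_reals all_analysis.
Set Implicit Arguments.
Unset Strict Implicit.
Unset Printing Implicit Defensive.
Import Order.TTheory GRing.Theory Num.Theory.
Import numFieldNormedType.Exports.
Local Open Scope classical_set_scope.
Local Open Scope ring_scope.

Section HalfLineProblem.
Variable R : realType.
Implicit Types (D : set R) (f phi : R -> R) (u : R -> R -> R).

Definition Omega : set R := `]0, +oo[.
Definition Omegabar : set R := `[0, +oo[.

(* Derivative of f at x relative to D: at an interior point of D it is the
   usual derivative, at an endpoint of an interval the one-sided one. The values
   of f outside D are irrelevant when x belongs to D. *)
Definition derivable_within D f (x : R) : Prop :=
  cvg ((f y - f x) / (y - x) @[y --> within D x^']).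
Definition derive_within D f (x : R) : R :=
  lim ((f y - f x) / (y - x) @[y --> within D x^']).

(* Functions of (x, t) are curried as u x t, with x in Omegabar; their values
   for x < 0 or t < 0 play no role. *)
Definition dx u (x t : R) : R := derive_within Omegabar (u^~ t) x.
Definition dt u (x t : R) : R := derive1 (u x) t.

Definition continuous_on2 (Q : set (R * R)) u : Prop :=
  {within Q, continuous (fun z : R * R => u z.1 z.2)}.

Definition C21 u : Prop :=
  [/\ forall x t : R, Omegabar x -> 0 < t ->
        [/\ derivable_within Omegabar (u^~ t) x,
            derivable_within Omegabar ((dx u)^~ t) x &
            derivable (u x) t 1]
    & let Q := Omegabar `*` `]0, +oo[ in
      [/\ continuous_on2 Q u, continuous_on2 Q (dx u),
          continuous_on2 Q (dx (dx u)) & continuous_on2 Q (dt u)]].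

(* The boundary of Omega is {0}, with outward unit normal -1. *)
Definition dnu u (t : R) : R := - dx u 0 t.

Definition global_solution (lambda p : R) phi u : Prop :=
  [/\ continuous_on2 (Omegabar `*` `[0, +oo[) u,
      C21 u,
      forall x t : R, Omegabar x -> 0 < t ->
        dt u x t = dx (dx u) x t - u x t * dx u x t
                   + u x t `^ p - lambda * u x t,
      forall t : R, 0 < t -> dnu u t = 0
    & forall x : R, Omegabar x -> u x 0 = phi x].

Definition positive_solution u : Prop :=
  forall x t : R, Omega x -> 0 < t -> 0 < u x t.

(* Inside Omega, |x| -> oo means x -> +oo. *)
Definition growth_condition u : Prop :=
  forall a t : R, 0 < a -> 0 < t ->
    (u x t * expR (- a * `|x|) @[x --> +oo] --> 0) /\
    (`|dx u x t| * expR (- a * `|x|) @[x --> +oo] --> 0).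

End HalfLineProblem.

(* Main.v *)
(* Put delta = min(1, - lambda / 2). A positive solution is a supersolution of
   w_t = w_xx - w w_x + delta (w^2 - w) - lambda w with zero flux at the origin.
   The functions w = A(t) cos(delta x) on [0, pi / (2 delta)] with
   A' = delta A^2 are subsolutions: they are decreasing in x, so the convection
   term has a favourable sign. They vanish at the right end of the interval and
   start below u when A is small, and A blows up in finite time whatever its
   initial value. By comparison u(0, t) >= A(t) blows up in finite time. *)
Require Import Defs.
From HB Require Import structures.
From mathcomp Require Import all_boot all_order all_algebra.
From mathcomp Require Import all_classical all_reals all_analysis.
From mathcomp Require Import ring lra.
Import Order.TTheory GRing.Theory Num.Theory.
Import numFieldNormedType.Exports.
Local Open Scope classical_set_scope.
Local Open Scope ring_scope.

(** * One-sided derivatives and conditions at a maximum *)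

Lemma derive_within_right (R : realType) (f : R -> R) (x : R) :
  0 <= x -> derivable_within (@Omegabar R) f x ->
  (f y - f x) / (y - x) @[y --> x^'+] --> derive_within (@Omegabar R) f x.
Proof.
move=> x0 df; apply: cvg_trans df; apply: cvg_app => A.
rewrite /within /= => nA; near=> y.
have xy : x < y by near: y; exact: nbhs_right_gt.
have /= : y != x -> Omegabar y -> A y by near: y; apply: cvg_within.
apply; first by rewrite gt_eqF.
by rewrite /Omegabar /= in_itv /= andbT (le_trans x0)// ltW.
Unshelve. all: by end_near. Qed.

(** For [x > 0] the closed half-line is a neighbourhood of [x], so restricting the difference
    quotient to it does not change the limit. *)
Lemma is_derive_within (R : realType) (f : R -> R) (x : R) :
  0 < x -> derivable_within (@Omegabar R) f x ->
  is_derive x 1 f (derive_within (@Omegabar R) f x).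
Proof.
move=> x0 df.
have H : h^-1 *: (f (h *: 1 + x) - f x) @[h --> 0^'] -->
    derive_within (@Omegabar R) f x.
  have qx : (f y - f x) / (y - x) @[y --> x^'] --> derive_within (@Omegabar R) f x.
    apply: cvg_trans df; apply: cvg_app => A.
    rewrite /within /= => nA; near=> y.
    have /= : y != x -> Omegabar y -> A y by near: y; apply: cvg_within.
    apply; first by near: y; exact: withinT.
    rewrite /Omegabar /= in_itv /= andbT ltW//; near: y.
    by apply: (@nbhs_dnbhs _ x (fun y => 0 < y)); exact: lt_nbhsr.
  have sh : (h + x) @[h --> (0:R)^'] --> x^'.
    move=> A nA; change (\forall h \near (0:R)^', A (h + x)).
    have {}nA : \forall y \near x, y != x -> A y by exact: nA.
    have : (fun h : R => h + x) @ (0 : R) --> x.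
      rewrite -[X in _ --> X]add0r; apply: cvgD => //; exact: cvg_cst.
    move=> /(_ _ nA) nhA; near=> h.
    have /= : h + x != x -> A (h + x).
      by near: h; apply: (@nbhs_dnbhs _ (0 : R) (fun h => h + x != x -> A (h + x))).
    apply; rewrite -subr_eq0 addrK; near: h; exact: withinT.
  apply: cvg_trans (cvg_comp _ _ sh qx); apply: near_eq_cvg.
  by near=> h; rewrite /= addrK mulrC /GRing.scale/= mulr1.
by apply: DeriveDef; [apply/cvg_ex; eexists; exact: H | exact: cvg_lim H].
Unshelve. all: by end_near. Qed.

(** If [l > 0], then [f'] is positive just to the right of [x], and the mean value theorem pushes
    [f] above its maximum. Only the right of [x] is inspected, so the test also applies at the
    endpoint 0, where the Neumann condition gives [f' x = 0]. *)
Lemma second_derivative_le0 (R : realType) (f f' : R -> R) (x L l : R) :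
  x < L -> (forall y, x <= y <= L -> f y <= f x) ->
  {within `[x, L], continuous f} ->
  (forall y, x < y -> is_derive y 1 f (f' y)) ->
  f' x = 0 -> (f' y - f' x) / (y - x) @[y --> x^'+] --> l -> l <= 0.
Proof.
move=> xL fmax fc df f'x f'q; rewrite leNgt; apply/negP => l0.
have : \forall y \near x^'+, 0 < (f' y - f' x) / (y - x).
  exact: (cvgr_gt l).
move=> [e /= e0 He].
pose d := Num.min (e / 2) (L - x).
have d0 : 0 < d by rewrite lt_min divr_gt0 // subr_gt0.
have de : d < e by rewrite (le_lt_trans (_ : d <= e / 2)) ?ge_min ?lexx// ltr_pdivrMr//; lra.
have dL : d <= L - x by rewrite ge_min lexx orbT.
have xd : x < x + d by rewrite ltrDl.
have df' y : y \in `]x, x + d[ -> is_derive y 1 f (f' y).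
  by rewrite in_itv /= => /andP[xy _]; exact: df.
have fc' : {within `[x, x + d], continuous f}.
  apply: continuous_subspaceW fc => y /=; rewrite !in_itv /= => /andP[-> yd] /=; lra.
have [c] := MVT xd df' fc'.
rewrite in_itv /= => /andP[xc cd] E.
have fle : f (x + d) <= f x by apply: fmax; lra.
have : 0 < (f' c - f' x) / (c - x).
  apply: He => //=; rewrite ltr0_norm; lra.
rewrite f'x subr0 pmulr_lgt0 ?invr_gt0 ?subr_gt0// => f'c.
have : 0 < f' c * (x + d - x) by rewrite mulr_gt0 // addrC addKr.
lra.
Qed.

(** With [g] the embedding of a line into the plane, this turns joint continuity into continuity of
    slices. *)
Lemma within_continuous_comp_sub (S T U : topologicalType) (A : set S)
    (B : set T) (g : S -> T) (f : T -> U) :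
  continuous g -> (forall x, A x -> B (g x)) -> {within B, continuous f} ->
  {within A, continuous (f \o g)}.
Proof.
move=> gc gAB /subspace_continuousP fc; apply/subspace_continuousP => x Ax.
apply: cvg_comp (fc _ (gAB _ Ax)) => P.
rewrite [in X in X -> _]/within /= => nP; near=> y.
have /= : B (g y) -> P (g y) by near: y; apply: cvg_within; exact: (gc x _ nP).
by apply; apply: gAB; near: y; exact: withinT.
Unshelve. all: by end_near. Qed.

Lemma is_derive_right (R : realType) (f : R -> R) (x d : R) :
  is_derive x 1 f d -> (f y - f x) / (y - x) @[y --> x^'+] --> d.
Proof.
move=> df.
have fq : h^-1 *: (f (h *: 1 + x) - f x) @[h --> 0^'] --> d.
  by rewrite -(@derive_val _ _ _ _ _ _ _ df); exact: (@ex_derive _ _ _ _ _ _ _ df).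
have sh : (y - x) @[y --> x^'+] --> (0 : R)^'.
  move=> A [e /= e0 He]; change (\forall y \near x^'+, A (y - x)).
  near=> y; have xy : x < y by near: y; exact: nbhs_right_gt.
  apply: He; last by rewrite /= subr_eq0 gt_eqF.
  rewrite /= sub0r normrN gtr0_norm ?subr_gt0// ltrBlDl.

  by near: y; apply: nbhs_right_lt; rewrite ltrDl.
apply: cvg_trans (cvg_comp _ _ sh fq); apply: near_eq_cvg; near=> y.
by rewrite /= /GRing.scale/= mulr1 subrK mulrC.
Unshelve. all: by end_near. Qed.

(** Difference quotients from the left are nonnegative. Looking only at the past allows the maximum
    to sit at the final time. *)
Lemma left_maximum_derive_ge0 (R : realType) (f : R -> R) (a t d : R) :
  a < t -> (forall s, a <= s <= t -> f s <= f t) -> is_derive t 1 f d -> 0 <= d.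
Proof.
move=> at_ fmax df; rewrite leNgt; apply/negP => d0.
have fq : h^-1 *: (f (h *: 1 + t) - f t) @[h --> 0^'] --> d.
  by rewrite -(@derive_val _ _ _ _ _ _ _ df); exact: (@ex_derive _ _ _ _ _ _ _ df).
have [e /= e0 He] : \forall h \near (0:R)^', h^-1 *: (f (h *: 1 + t) - f t) < 0.
  exact: (cvgr_lt d).
pose h := Num.min (e / 2) (t - a).
have h0 : 0 < h by rewrite lt_min divr_gt0 // subr_gt0.
have he : h < e by rewrite (le_lt_trans (_ : h <= e / 2)) ?ge_min ?lexx// ltr_pdivrMr//; lra.
have hL : h <= t - a by rewrite ge_min lexx orbT.
have : (- h)^-1 *: (f (- h *: 1 + t) - f t) < 0.
  apply: He => /=; last by rewrite oppr_eq0 gt_eqF.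
  by rewrite sub0r opprK gtr0_norm.
rewrite /GRing.scale /= mulr1 invrN mulNr oppr_lt0 pmulr_rgt0 ?invr_gt0//.
have : f (- h + t) <= f t by apply: fmax; lra.
lra.
Qed.

(** * Comparison principle with a quadratic reaction term *)

(** For [y >= 1] the power dominates [y ^+ 2]; for [y < 1] the left side is nonpositive, thanks to
    the subtracted [y]. *)
Lemma powR_ge_quadratic (R : realType) (p d y : R) :
  2 <= p -> 0 <= d <= 1 -> 0 <= y -> d * (y ^+ 2 - y) <= y `^ p.
Proof.
move=> p2 /andP[d0 d1] y0; have [y1|y1] := leP 1 y.
  apply: (@le_trans _ _ (y ^+ 2)); last first.
    by rewrite -powR_mulrn// ler_powR.
  nra.
apply: le_trans (powR_ge0 _ _); rewrite mulr_ge0_le0//; nra.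
Qed.

(* Since [u `^ p >= delta * (u ^+ 2 - u)], the solution u is a supersolution of
   the equation with this quadratic reaction term, and w is a subsolution
   wherever it is positive; at a positive maximum of exp(-K t) (w - u) the
   two first space derivatives agree. *)
Lemma comparison (R : realType) (lambda p : R) (phi : R -> R)
    (u w wx wxx wt : R -> R -> R) (delta L t0 t1 K : R) :
  2 <= p -> 0 <= delta <= 1 -> 0 < t0 -> 0 < L ->
  global_solution lambda p phi u ->
  (forall x t : R, 0 <= x -> 0 < t -> 0 <= u x t) ->
  {within `[0, L] `*` `[t0, t1], continuous (fun z : R * R => w z.1 z.2)} ->
  (forall x t : R, t0 <= t <= t1 ->
    [/\ is_derive x 1 (w^~ t) (wx x t), is_derive x 1 (wx^~ t) (wxx x t)
      & is_derive t 1 (w x) (wt x t)]) ->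
  (forall t : R, t0 <= t <= t1 -> wx 0 t = 0) ->
  (forall x t : R, 0 <= x <= L -> t0 <= t <= t1 -> 0 < w x t ->
    wt x t <= wxx x t - w x t * wx x t
              + delta * (w x t ^+ 2 - w x t) - lambda * w x t) ->
  (forall x t : R, 0 <= x <= L -> t0 <= t <= t1 ->
    2 * delta * w x t - wx x t - lambda - delta < K) ->
  (forall x : R, 0 <= x <= L -> w x t0 <= u x t0) ->
  (forall t : R, t0 <= t <= t1 -> w L t <= u L t) ->
  forall x t : R, 0 <= x <= L -> t0 <= t <= t1 -> w x t <= u x t.
Proof.
move=> p2 hd t00 L0 [_ [Hd [cu _ _ _]] eqn bd _] u0 cw dw wx0 sub HK init lat.
move=> x t xL t01.
pose Q : set (R * R) := `[0, L] `*` `[t0, t1].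
pose v := fun z : R * R => expR (- K * z.2) * (w z.1 z.2 - u z.1 z.2).
have cu' : {within Q, continuous (fun z : R * R => u z.1 z.2)}.
  apply: continuous_subspaceW cu => -[a b] [/=]; rewrite !in_itv /=.
  move=> /andP[a0 _] /andP[tb _]; split; rewrite /Omegabar /= ?in_itv /= andbT//.
  exact: lt_le_trans t00 tb.
have cv : {within Q, continuous v}.
  move=> z; apply: cvgM; last by apply: cvgB; [exact: cw|exact: cu'].
  apply: (@continuous_subspaceT _ _ Q (fun z : R * R => expR (- K * z.2))) => {}z.
  apply: continuous_comp; last exact: continuous_expR.
  by apply: cvgM; [exact: cvg_cst|exact: cvg_snd].
have Qc : compact Q by apply: compact_setX; exact: segment_compact.
have Q0 : Q !=set0 by exists (x, t); split; rewrite /= in_itv.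
have [[/= a s]] := compact_EVT_max Q0 Qc cv.
rewrite inE => -[/=]; rewrite !in_itv /= => aL s01 vmax.
have {}vmax (y r : R) : 0 <= y <= L -> t0 <= r <= t1 -> v (y, r) <= v (a, s).
  by move=> ? ?; apply: vmax; rewrite inE; split; rewrite /= in_itv.
(* The exponential weight is positive, so it is enough to find the sign of [w - u] at the maximum
   point [(a, s)] of [v]. *)
rewrite -subr_le0 -(@pmulr_rle0 _ (expR (- K * t))) ?expR_gt0//.
apply: (le_trans (vmax x t xL t01)).
rewrite /v /= pmulr_rle0 ?expR_gt0// leNgt; apply/negP => D0.
(* The lateral and initial bounds exclude [a = L] and [s = t0]; the cases [a = 0] and [s = t1]
   remain possible. *)
have {aL}aL : 0 <= a < L.
  have /andP[-> aL'] := aL; rewrite lt_neqAle aL' andbT; apply/eqP => aE.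
  by have := lat s s01; rewrite -aE; lra.
have {s01}s01 : t0 < s <= t1.
  have /andP[s0 ->] := s01; rewrite andbT lt_neqAle s0 andbT; apply/eqP => aE.
  by have := init a; rewrite aE; lra.
have s0 : 0 < s by lra.
have a0 : 0 <= a by lra.
have hs : t0 <= s <= t1 by lra.
have Oa : @Omegabar R a by rewrite /Omegabar /= in_itv /= andbT.
have [d1 d2 d3] := Hd a s Oa s0.
have fmax (y : R) : 0 <= y <= L -> w y s - u y s <= w a s - u a s.
  by move=> yL; have := vmax y s yL hs; rewrite /v /= ler_pM2l ?expR_gt0.
pose g := fun y : R => w y s - u y s.
pose g' := fun y : R => wx y s - dx u y s.
have dg (y : R) : 0 < y -> is_derive y 1 g (g' y).
  move=> y0; apply: is_deriveB; first by have [] := dw y s hs.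
  have Oy : @Omegabar R y by rewrite /Omegabar /= in_itv /= andbT ltW.
  by have [dy _ _] := Hd y s Oy s0; exact: is_derive_within _ _ _ y0 dy.
(* At [a = 0] both slopes vanish by the Neumann conditions; elsewhere [a] is an interior maximum. *)
have g'a : g' a = 0.
  have [->|an0] := eqVneq a 0.
    by rewrite /g' wx0//; have := bd s s0; rewrite /dnu; lra.
  have a00 : 0 < a by rewrite lt_neqAle eq_sym an0.
  have [] := @derive1_at_max R g 0 L a; rewrite ?in_itv /=.
  - lra.
  - by move=> y; rewrite in_itv /= => /andP[/dg[]].
  - lra.
  - by move=> y; rewrite in_itv /= => yL; apply: fmax; lra.
  by move=> _ <-; have [_ <-] := dg a a00.
have xx : wxx a s - dx (dx u) a s <= 0.
  have aL2 : a < L by lra.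
  apply: (@second_derivative_le0 R g g' a L _ aL2 _ _ _ g'a).
  - by move=> y yL; apply: fmax; lra.
  - apply: (@within_continuous_comp_sub _ _ _ _ Q (fun y : R => (y, s))
      (fun z => w z.1 z.2 - u z.1 z.2)).
    + by move=> y; exact: (@cvg_pair _ _ _ (nbhs y) _ _ _ _ _ id (cst s) (fun A => id) (cvg_cst s)).
    + by move=> y /=; rewrite in_itv /= => yL; split; rewrite /= in_itv //=; lra.
    + by move=> z; apply: cvgB; [exact: cw|exact: cu'].
  - by move=> y ay; apply: dg; lra.
  have cd := derive_within_right _ _ _ a0 d2.
  have dwx : is_derive a 1 (wx^~ s) (wxx a s) by have [] := dw a s hs.
  have cw2 := is_derive_right _ _ _ _ dwx.
  apply: cvg_trans (cvgB cw2 cd); apply: near_eq_cvg; near=> y.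
  by rewrite /= /g' -mulrBl; congr (_ / _); rewrite !fctE; ring.
(* This is the sign of the time derivative of [v] at its maximum, with the weight divided out. *)
have tt : K * (w a s - u a s) <= wt a s - dt u a s.
  have du : is_derive s 1 (u a) (dt u a s).
    by rewrite /dt derive1E; apply/derivableP.
  have dws : is_derive s 1 (w a) (wt a s) by have [] := dw a s hs.
  have : 0 <= expR (- K * s) * (wt a s - dt u a s - K * (w a s - u a s)).
    apply: (@left_maximum_derive_ge0 R (fun r => v (a, r)) t0 s).
    - lra.
    - by move=> r rs; apply: vmax; lra.
    rewrite /v /=; apply: is_derive_eq; rewrite /GRing.scale /=; ring.
  by rewrite pmulr_rge0 ?expR_gt0//; lra.
have U0 := u0 a s a0 s0.
have W0 : 0 < w a s by lra.
have aL' : 0 <= a <= L by lra.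
have := sub a s aL' hs W0.
have := HK a s aL' hs.
have := eqn a s Oa s0.
have := powR_ge_quadratic _ _ _ _ p2 hd U0.
have wxE : wx a s = dx u a s by move: g'a; rewrite /g'; lra.
rewrite wxE.
move: (wt a s) (dt u a s) (wxx a s) (dx (dx u) a s) (dx u a s) (u a s `^ p) xx tt D0 U0.
move: (w a s) (u a s) => W U Wt Ut Wxx Uxx Ux P xx tt D0 U0 E1 E2 E3 E4.
(* With equal slopes the drift terms differ by [Ux * (W - U)], and [W ^+ 2 - U ^+ 2 = 2 * W * (W -
   U) - (W - U) ^+ 2]. Hence [Wt - Ut] is at most the left side of [KD], which contradicts [tt]. *)
have DD : delta * ((W - U) * (W - U)) >= 0.
  by rewrite mulr_ge0 ?mulr_ge0//; lra.
have KD : (2 * delta * W - Ux - lambda - delta) * (W - U) < K * (W - U).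
  by rewrite ltr_pM2r.
lra.
Unshelve. all: by end_near. Qed.

(** * Lower bounds for positive solutions, up to the boundary point *)

Lemma solution_slice_continuous (R : realType) (lambda p : R) (phi : R -> R)
    (u : R -> R -> R) :
  global_solution lambda p phi u ->
  (forall t : R, 0 < t -> {within @Omegabar R, continuous (u^~ t)}) /\
  (forall x : R, 0 <= x -> {within `]0, +oo[, continuous (u x)}).
Proof.
move=> [_ [_ [cu _ _ _]] _ _ _]; split.
- move=> t t0.
  apply: (@within_continuous_comp_sub R (R * R)%type R _ (@Omegabar R `*` `]0, +oo[)
    (fun y : R => (y, t)) (fun z => u z.1 z.2)); last exact: cu.
    by move=> y; exact: (@cvg_pair _ _ _ (nbhs y) _ _ _ _ _ id (cst t) (fun A => id) (cvg_cst t)).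
  by move=> y Oy; split => //=; rewrite in_itv /= andbT.
- move=> x x0.
  apply: (@within_continuous_comp_sub R (R * R)%type R _ (@Omegabar R `*` `]0, +oo[)
    (fun s : R => (x, s)) (fun z => u z.1 z.2)); last exact: cu.
    by move=> y; exact: (@cvg_pair _ _ _ (nbhs y) _ _ _ _ _ (cst x) id (cvg_cst x) (fun A => id)).
  by move=> s Os; split => //; rewrite /Omegabar /= in_itv /= andbT.
Qed.

(** The boundary value is a limit of positive interior values. *)
Lemma solution_ge0 (R : realType) (lambda p : R) (phi : R -> R)
    (u : R -> R -> R) :
  global_solution lambda p phi u -> positive_solution u ->
  forall x t : R, 0 <= x -> 0 < t -> 0 <= u x t.
Proof.
move=> usol upos x t; rewrite le_eqVlt => /predU1P[<-|x0] t0; last first.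
  by apply/ltW/upos => //; rewrite /Omega /= in_itv /= andbT.
have [/(_ t t0) /subspace_continuousP cu _] := solution_slice_continuous _ _ _ _ _ usol.
have O0 : @Omegabar R 0 by rewrite /Omegabar /= in_itv /= lexx.
have cr : u y t @[y --> 0^'+] --> u 0 t.
  apply: cvg_trans (cu 0 O0); apply: cvg_app => A nA; near=> y.
  have y0 : 0 < y by near: y; exact: nbhs_right_gt.
  have /= : Omegabar y -> A y.
    by near: y; apply: cvg_within; exact: nA.
  by apply; rewrite /Omegabar /= in_itv /= andbT ltW.
rewrite -(cvg_lim _ cr)//; apply: limr_ge; first by apply/cvg_ex; eexists; exact: cr.
near=> y; apply/ltW/upos => //; rewrite /Omega /= in_itv /= andbT.
by near: y; exact: nbhs_right_gt.
Unshelve. all: by end_near. Qed.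

(* Positivity is assumed only in the open half-line. The barrier
   [e * (x ^+ 2 + t - t0 - 1)] on [0, 1] is nonpositive at time t0 and equals e
   at the origin at time t0 + 2. *)
Lemma solution_boundary_gt0 (R : realType) (lambda p : R) (phi : R -> R)
    (u : R -> R -> R) (t0 : R) :
  lambda < 0 -> 2 <= p -> global_solution lambda p phi u ->
  positive_solution u -> 0 < t0 -> 0 < u 0 (t0 + 2).
Proof.
move=> l0 p2 usol upos t00.
have u0 := solution_ge0 _ _ _ _ _ usol upos.
have [_ cu] := solution_slice_continuous _ _ _ _ _ usol.
have cu1 : {within `[t0, t0 + 2], continuous (u 1)}.
  apply: continuous_subspaceW (cu 1 ler01) => s /=; rewrite !in_itv /=; lra.
have t02 : t0 <= t0 + 2 by lra.
have [c] := EVT_min t02 cu1; rewrite in_itv /= => c0 umin.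
pose m := u 1 c.
have m0 : 0 < m by apply: upos; [rewrite /Omega /= in_itv /= ltr01|lra].
(* The barrier is at most [2 * e]. The bound [m / 2] keeps it below [u] at [x = 1]; the bound
   [1 / 4] makes it at most [1 / 2] there and inside, so the drift takes away at most [e] of the
   diffusion [2 * e] and leaves the time derivative [e]. *)
pose e := Num.min (m / 2) (1 / 4).
have e0 : 0 < e by rewrite lt_min !divr_gt0.
have em : e <= m / 2 by rewrite ge_min lexx.
have e4 : e <= 1 / 4 by rewrite ge_min lexx orbT.
clearbody e.
pose w x t := e * (x ^+ 2 + t - t0 - 1).
suff : w 0 (t0 + 2) <= u 0 (t0 + 2).
  by apply: lt_le_trans; rewrite /w expr0n /=; nra.
pose d := Num.min 1 (- lambda / 2).
have d0 : 0 <= d by rewrite le_min; apply/andP; split; lra.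
have d1 : d <= 1 by rewrite ge_min lexx.
have dl : d <= - lambda / 2 by rewrite ge_min lexx orbT.
clearbody d.
have wle x t : 0 <= x <= 1 -> t0 <= t <= t0 + 2 -> w x t <= 2 * e.
  move=> x01 t01; have x2 : x ^+ 2 <= 1 by rewrite expr_le1 //; lra.
  by rewrite /w mulrC ler_pM2r; lra.
apply: (@comparison R lambda p phi u w (fun x _ => e * (2 * x))
  (fun _ _ => e * 2) (fun _ _ => e) d 1 t0 (t0 + 2) (2 - lambda)) => //.
- lra.
- apply: continuous_subspaceT => z; rewrite /w.
  by apply: cvgM; [exact: cvg_cst|]; apply: cvgB; [|exact: cvg_cst];
    apply: cvgB; [|exact: cvg_cst]; apply: cvgD;
    [apply: (@cvg_comp _ _ _ _ (fun x : R => x ^+ 2)); [exact: cvg_fst|exact: exprn_continuous]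
    |exact: cvg_snd].
- move=> x t _; split; rewrite /w; apply: is_derive_eq; rewrite /GRing.scale /=; ring.
- by move=> t _; rewrite !mulr0.
- move=> x t x01 t01 w0; have := wle x t x01 t01.
  move: (w x t) w0 => W W0 W2.
  have WW : 0 <= d * W ^+ 2 by rewrite mulr_ge0 ?sqr_ge0.
  have lW : 0 <= (- lambda - d) * W by rewrite mulr_ge0; lra.
  have Wx : W * x <= W by rewrite ler_piMr//; lra.
  have eWx : e * (W * x) <= e * (1 / 2) by rewrite ler_wpM2l//; lra.
  lra.
- move=> x t x01 t01; have := wle x t x01 t01.
  move: (w x t) => W W2.
  have dW : d * W <= d * (1 / 2) by rewrite ler_wpM2l//; lra.
  have ex : 0 <= e * x by rewrite mulr_ge0; lra.
  lra.
- move=> x x01; apply: (le_trans (y := 0)); last by apply: u0; lra.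
  have x2 : x ^+ 2 <= 1 by rewrite expr_le1 //; lra.
  by rewrite /w mulr_ge0_le0; lra.
- move=> t t01; have := umin t; rewrite in_itv /= => /(_ t01); apply: le_trans.
  have : e * (t - t0) <= e * 2 by rewrite ler_wpM2l; lra.
  rewrite /w -/m expr1n; lra.
- lra.
- lra.
Qed.

(* The barrier [A t * cos (delta * x)] with [A' = delta * A ^+ 2] is a subsolution
   because [cos + sin >= 1] on the first quadrant: near the right end of the
   interval, where the reaction [delta * A * cos] is weak, the drift
   [delta * A * sin] takes over. *)
Lemma solution_boundary_blowup (R : realType) (lambda p : R) (phi : R -> R)
    (u : R -> R -> R) (delta m t0 t1 : R) :
  2 <= p -> 0 < delta -> delta <= 1 -> delta <= - lambda / 2 ->
  global_solution lambda p phi u -> positive_solution u ->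
  0 < m -> 0 < t0 -> t0 <= t1 -> 0 < m^-1 - delta * (t1 - t0) ->
  (forall x : R, 0 <= x <= pi / 2 / delta -> m <= u x t0) ->
  1 <= u 0 t1 * (m^-1 - delta * (t1 - t0)).
Proof.
move=> p2 d0 d1 dl usol upos m0 t00 t01 q1 um.
have u0 := solution_ge0 _ _ _ _ _ usol upos.
(* [q] is the reciprocal of the amplitude [A]: the equation [A' = delta * A ^+ 2] makes it affine
   with slope [- delta], and [A t0 = m]. *)
pose q t := m^-1 - delta * (t - t0).
have qle t : t0 <= t <= t1 -> q t1 <= q t.
  by move=> tt; rewrite lerB// ler_pM2l//; lra.
have qgt0 t : t0 <= t <= t1 -> 0 < q t.
  by move=> /qle; apply: lt_le_trans.
pose w x t := cos (delta * x) / q t.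
suff : w 0 t1 <= u 0 t1.
  by rewrite /w mulr0 cos0 ler_pdivrMr//; exact: q1.
(* The first zero of [cos (delta * x)], so that the barrier vanishes at the lateral end. *)
pose L := pi / 2 / delta.
have pi20 : 0 < pi / 2 :> R by rewrite divr_gt0 ?pi_gt0.
have L0 : 0 < L by rewrite divr_gt0.
have dx_itv x : 0 <= x <= L -> 0 <= delta * x <= pi / 2.
  move=> /andP[x0 xL]; rewrite mulr_ge0 ?(ltW d0)//=.
  by rewrite mulrC -ler_pdivlMr.
(* In the last argument, [2 * delta * w] contributes at most [2 * delta / q t1] and [- wx] at most
   [delta / q t1], since [q] decreases. *)
apply: (@comparison R lambda p phi u w
  (fun x t => - delta * sin (delta * x) / q t)
  (fun x t => - delta ^+ 2 * cos (delta * x) / q t)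
  (fun x t => cos (delta * x) * delta / q t ^+ 2)
  delta L t0 t1 (3 * delta / q t1 - lambda)) => //.
- by rewrite (ltW d0).
- apply/subspace_continuousP => -[x t] [/= _]; rewrite in_itv /= => tt.
  apply: cvg_within_filter; apply: cvgM.
    apply: (@continuous_comp _ _ _ (fun z : R * R => delta * z.1) cos).
      by apply: cvgM; [exact: cvg_cst|exact: cvg_fst].
    exact: continuous_cos.
  apply: cvgV; first by rewrite /= gt_eqF// qgt0.
  apply: cvgB; first exact: cvg_cst.
  apply: cvgM; first exact: cvg_cst.
  by apply: cvgB; [exact: cvg_snd|exact: cvg_cst].
- move=> x t tt; have q0 : q t != 0 by rewrite gt_eqF// qgt0.
  split; rewrite /w.
  + apply: is_derive_eq; rewrite /GRing.scale /=; ring.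
  + apply: is_derive_eq; rewrite /GRing.scale /=; ring.
  + apply: is_derive_eq; rewrite /GRing.scale /=; ring.
- by move=> t _; rewrite mulr0 sin0 mulr0 mul0r.
- move=> x t /dx_itv xL /qgt0 q0; rewrite /w.
  have S0 : 0 <= sin (delta * x).
    by rewrite sin_ge0_pi//; lra.
  have := cos2Dsin2 (delta * x).
  move: (sin _) (cos _) S0 => S C S0 CS; rewrite -exprVn.
  have A0 : 0 < (q t)^-1 by rewrite invr_gt0.
  rewrite pmulr_lgt0//; move: (q t)^-1 A0 => A A0 C0.
  have SC : 1 <= S + C by nra.
  (* The subsolution defect is the sum of this product and the next one. The next one is nonnegative
     because [delta ^+ 2 <= delta <= - lambda / 2]. *)
  have : 0 <= C * A * (delta * A * (S + C - 1)).
    by rewrite !mulr_ge0//; lra.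
  have : 0 <= C * A * (- lambda - delta - delta ^+ 2).
    by rewrite !mulr_ge0//; [lra..|nra].
  lra.
- move=> x t /dx_itv xL tt; have q0 := qgt0 t tt.
  have AA : (q t)^-1 <= (q t1)^-1 by rewrite lef_pV2 ?posrE ?qle// qgt0// t01 lexx.
  have A0 : 0 < (q t)^-1 by rewrite invr_gt0.
  rewrite /w; move: (cos_le1 (delta * x)) (sin_le1 (delta * x)).
  move: (sin _) (cos _) => S C C1 S1.
  have : delta * (q t)^-1 <= delta * (q t1)^-1 by rewrite ler_pM2l.
  have : delta * (q t)^-1 * C <= delta * (q t)^-1.
    by rewrite ler_piMr// mulr_ge0// ltW.
  have : delta * (q t)^-1 * S <= delta * (q t)^-1.
    by rewrite ler_piMr// mulr_ge0// ltW.
  lra.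
- move=> x xL; rewrite /w /q subrr mulr0 subr0 invrK.
  apply: le_trans (um x xL); rewrite ler_piMl ?(ltW m0)//; exact: cos_le1.
- move=> t tt; rewrite /w /L [delta * _]mulrC divfK ?gt_eqF// cos_pihalf mul0r.
  by apply: u0; [exact: ltW|lra].
- by rewrite lexx ltW.
- by rewrite t01 lexx.
Qed.

(** * Contradiction at the blow-up time *)

Theorem theorem3p9 (R : realType) (lambda p : R) (phi : R -> R)
    (hlambda : lambda < 0) (hp : 2 <= p)
    (phi_cont : {within @Omegabar R, continuous phi})
    (phi_ge0 : forall x, Omegabar x -> 0 <= phi x) :
  ~ exists u : R -> R -> R,
      [/\ global_solution lambda p phi u, positive_solution u
        & growth_condition u].
Proof.
move=> [u [usol upos _]].
pose d := Num.min 1 (- lambda / 2).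
have d0 : 0 < d by rewrite lt_min; apply/andP; split; lra.
have d1 : d <= 1 by rewrite ge_min lexx.
have dl : d <= - lambda / 2 by rewrite ge_min lexx orbT.
clearbody d.
(* Positivity at the endpoint, gained at time 3 from the barrier started at time 1, makes the
   minimum of [u] over the compact interval [[0, L]] positive at that time. *)
have u03 : 0 < u 0 (1 + 2) by exact: solution_boundary_gt0 hlambda hp usol upos ltr01.
have t00 : 0 < 1 + 2 :> R by lra.
move: (1 + 2) u03 t00 => t0 u03 t00.
have [cux _] := solution_slice_continuous _ _ _ _ _ usol.
pose L : R := pi / 2 / d.
have L0 : 0 <= L by rewrite !divr_ge0 ?pi_ge0// ltW.
have cu : {within `[0, L], continuous (u^~ t0)}.
  apply: continuous_subspaceW (cux t0 t00) => x /=.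
  by rewrite /Omegabar /= !in_itv /= andbT => /andP[].
have [c] := EVT_min L0 cu; rewrite in_itv /= => /andP[c0 _] umin.
have m0 : 0 < u c t0.
  move: c0; rewrite le_eqVlt => /predU1P[<-//|c0].
  by apply: upos => //; rewrite /Omega /= in_itv /= c0.
move: (u c t0) m0 umin => m m0 umin.
(* [T] is the zero of the reciprocal amplitude. The lower bound reads [1 <= f t] for all [t] in
   [[t0, T[], while [f T = 0]; continuity of [f] at [T] forbids this. *)
pose T := t0 + m^-1 / d.
pose f t := u 0 t * (m^-1 - d * (t - t0)).
have t0T : t0 < T by rewrite ltrDl divr_gt0// invr_gt0.
have fge1 t : t0 <= t -> t < T -> 1 <= f t.
  move=> t0t tT; apply: (solution_boundary_blowup _ _ _ _ _ d m t0 t hp d0 d1 dl usol upos m0 t00 t0t).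
    by rewrite subr_gt0 mulrC -ltr_pdivlMr// ltrBlDl.
  by move=> x xL; apply: umin; rewrite in_itv.
have fT : f T = 0.
  by rewrite /f /T [t0 + _]addrC addrK [d * _]mulrC divfK ?gt_eqF// subrr mulr0.
have cf : {for T, continuous f}.
  apply: cvgM.
    have O0 : @Omegabar R 0 by rewrite /Omegabar /= in_itv /= lexx.
    have [_ [Hd _] _ _ _] := usol.
    have [_ _ du] := Hd 0 T O0 (lt_trans t00 t0T).
    exact/differentiable_continuous/derivable1_diffP.
  apply: cvgB; first exact: cvg_cst.
  apply: cvgM; first exact: cvg_cst.
  by apply: cvgB; [exact: cvg_id|exact: cvg_cst].
have nf : \forall t \near T, f t < 1.
  by apply: (cvgr_lt (f T) cf); rewrite fT ltr01.
near T^'- => t.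
have ft : f t < 1.
  by near: t; exact: (cvg_within _ nf).
have : 1 <= f t.
  apply: fge1; last by near: t; exact: nbhs_left_lt.
  by near: t; exact: nbhs_left_ge.
by rewrite leNgt ft.
Unshelve. all: by end_near. Qed.
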